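(* Let $G=(V,E)$ be an instance of unweighted, complete correlation clustering and suppose that the subgraph formed by the positive edges $E^+$ is regular. Then the fractional cost of the correlation metric $d$ in the $\ell_1$-norm objective is within a constant factor of $\mathsf{OPT}(1)$: $$\sum_{u\in V}\sum_{v\in N_u^+} d_{uv} + \sum_{u\in V}\sum_{v\in N_u^-}(1-d_{uv}) = O(\mathsf{OPT}(1)).$$ Consequently, the clustering produced by the KMZ rounding algorithm with input $d$ is a constant-factor approximation simultaneously for the $\ell_1$-norm and the $\ell_\infty$-norm objectives.
   Context: An instance is a complete graph $G=(V,E)$, $|V|=n$, with every edge labeled positive ($+$, set $E^+$) or negative ($-$, set $E^-$); by convention every vertex has a positive self-loop. $N_u^+=\{v:(u,v)\in E^+\}$ (so $u\in N_u^+$) and $N_u^-=\{v:(u,v)\in E^-\}$. A clustering is a partition of $V$; a positive edge is a disagreement if its endpoints are in different clusters, a negative edge if its endpoints are in the same cluster; $y_{\mathcal{C}}(u)$ is the number of disagreements at $u$, and $\mathsf{OPT}(p)=\min_{\mathcal{C}}\lVert y_{\mathcal{C}}\rVert_p$. The correlation metric is $d_{uv}=1-\frac{|N_u^+\cap N_v^+|}{|N_u^+\cup N_v^+|}$ for $u,v\in V$. The KMZ rounding algorithm, given a semi-metric $z$ on $V$: set $r=1/5$, $V_0=V$, $t=0$; while $V_t\neq\emptyset$, let $\mathrm{Ball}(u,\rho)=\{v: z_{uv}\le\rho\}$, pick $u_t^*\in\arg\max_{u\in V_t}\sum_{v\in \mathrm{Ball}(u,r)\cap V_t}(r-z_{uv})$,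 create cluster $C_t=\mathrm{Ball}(u_t^*,2r)\cap V_t$, set $V_{t+1}=V_t\setminus C_t$ and $t\leftarrow t+1$; output $(C_0,\dots,C_{t-1})$. *)

(* Defs.v *)
From HB Require Import structures.
From mathcomp Require Import all_boot all_order all_algebra.
From mathcomp Require Import reals constructive_ereal exp.
Set Implicit Arguments.
Unset Strict Implicit.
Unset Printing Implicit Defensive.
Import Order.TTheory GRing.Theory Num.Theory.
Local Open Scope ring_scope.

(* A complete graph on V with signed edges.  [pos] is E^+, positive
   self-loops included; a negative edge is any pair that is not positive. *)
Record cc_instance (V : finType) := CCInstance {
  pos : rel V;
  pos_sym : symmetric pos;
  pos_refl : reflexive pos }.

Definition Npos (V : finType) (G : cc_instance V) (u : V) : {set V} :=
  [set v | pos G u v].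

Definition Nneg (V : finType) (G : cc_instance V) (u : V) : {set V} :=
  [set v | ~~ pos G u v].

Definition pos_regular (V : finType) (G : cc_instance V) : Prop :=
  exists k : nat, forall u : V, #|Npos G u| = k.

Definition is_clustering (V : finType) (C : {set {set V}}) : bool :=
  partition C [set: V].

(* Edges at u are identified with their other endpoint; the self-loop at u is
   never counted, since u \in pblock C u for a clustering C. *)
Definition disagreements (V : finType) (G : cc_instance V) (C : {set {set V}})
    (u : V) : nat :=
  (#|[set v in Npos G u | v \notin pblock C u]|
   + #|[set v in Nneg G u | v \in pblock C u]|)%N.

(* Only p = +oo and finite p >= 1 are meaningful; -oo gets a junk value. *)
Definition lp_norm (R : realType) (V : finType) (p : \bar R) (f : V -> R) : R :=
  match p with
  | q%:E => powR (\sum_(u : V) powR `|f u| q) q^-1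
  | +oo%E => \big[Num.max/0]_(u : V) `|f u|
  | -oo%E => 0
  end.

Definition clustering_cost (R : realType) (V : finType) (G : cc_instance V)
    (p : \bar R) (C : {set {set V}}) : R :=
  lp_norm p (fun u => (disagreements G C u)%:R).

(* The partition into singletons, [preim_partition id setT], only serves as
   the witness that the set of clusterings is nonempty. *)
Definition OPT (R : realType) (V : finType) (G : cc_instance V)
    (p : \bar R) : R :=
  clustering_cost G p
    [arg min_(C < preim_partition id [set: V] | is_clustering C)
       clustering_cost G p C]%O.

Definition corr_metric (R : realType) (V : finType) (G : cc_instance V)
    (u v : V) : R :=
  1 - #|Npos G u :&: Npos G v|%:R / #|Npos G u :|: Npos G v|%:R.

Definition ball (R : realType) (V : finType) (z : V -> V -> R) (u : V)
    (rho : R) : {set V} :=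
  [set v | z u v <= rho].

Definition kmz_radius (R : realType) : R := 1 / 5%:R.

Definition kmz_weight (R : realType) (V : finType) (z : V -> V -> R)
    (W : {set V}) (u : V) : R :=
  \sum_(v in ball z u (kmz_radius R) :&: W) (kmz_radius R - z u v).

Definition kmz_cluster (R : realType) (V : finType) (z : V -> V -> R)
    (W : {set V}) (u : V) : {set V} :=
  ball z u (2%:R * kmz_radius R) :&: W.

(* [kmz_run z W s]: started with remaining vertex set W, the loop can
   terminate having produced the clusters s in this order.  It is a relation
   because ties in the argmax may be broken arbitrarily. *)
Inductive kmz_run (R : realType) (V : finType) (z : V -> V -> R) :
    {set V} -> seq {set V} -> Prop :=
| kmz_stop : kmz_run z set0 [::]
| kmz_step (W : {set V}) (u : V) (s : seq {set V}) :
    u \in W ->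
    (forall w, w \in W -> kmz_weight z W w <= kmz_weight z W u) ->
    kmz_run z (W :\: kmz_cluster z W u) s ->
    kmz_run z W (kmz_cluster z W u :: s).

Definition kmz_output (R : realType) (V : finType) (z : V -> V -> R)
    (C : {set {set V}}) : Prop :=
  exists2 s : seq {set V}, kmz_run z [set: V] s & C = [set:: s].

Definition approximates (R : realType) (V : finType) (G : cc_instance V)
    (c : R) (p : \bar R) (C : {set {set V}}) : Prop :=
  is_clustering C /\ clustering_cost G p C <= c * OPT G p.

Lemma OPT_min (R : realType) (V : finType) (G : cc_instance V) (p : \bar R)
    (C : {set {set V}}) :
  is_clustering C -> OPT G p <= clustering_cost G p C.
Proof.
rewrite /OPT; case: arg_minP => [|D _]; last by apply.
exact: preim_partitionP.
Qed.

Lemma OPT_attained (R : realType) (V : finType) (G : cc_instance V)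
    (p : \bar R) :
  exists2 C, is_clustering C & clustering_cost G p C = OPT G p.
Proof.
rewrite /OPT; case: arg_minP => [|D PD _]; last by exists D.
exact: preim_partitionP.
Qed.

Lemma corr_metric_diag (R : realType) (V : finType) (G : cc_instance V)
    (u : V) : corr_metric R G u u = 0.
Proof.
rewrite /corr_metric setIid setUid divff ?subrr // pnatr_eq0 -lt0n.
by apply/card_gt0P; exists u; rewrite inE pos_refl.
Qed.

Lemma kmz_output_exists (R : realType) (V : finType) (z : V -> V -> R) :
  (forall u, z u u = 0) -> exists C, kmz_output z C.
Proof.
move=> z0; suff [s sP] : exists s, kmz_run z [set: V] s.
  by exists [set:: s]; exists s.
move: [set: V] => W.
have [n] := ubnP #|W|; elim: n W => // n IHn W leWn.
have [->|[u0 u0W]] := set_0Vmem W; first by exists [::]; constructor.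
have [u uW umax] : exists2 u, u \in W &
    forall w, w \in W -> kmz_weight z W w <= kmz_weight z W u.
  by case: (@arg_maxP _ R V u0 (mem W) (kmz_weight z W) u0W) => u; exists u.
have [|s sP] := IHn (W :\: kmz_cluster z W u).
  rewrite -ltnS; apply: leq_trans leWn; rewrite ltnS.
  apply/proper_card/properP; split; first exact: subsetDl.
  by exists u; rewrite // !inE z0 uW andbT negbK mulr_ge0 ?divr_ge0 ?ler0n.
by exists (kmz_cluster z W u :: s); apply: kmz_step.
Qed.

(* Main.v *)
Require Import Defs.
From HB Require Import structures.
From mathcomp Require Import all_boot all_order all_algebra.
From mathcomp Require Import reals constructive_ereal exp.
From mathcomp Require Import ring lra zify.
Set Implicit Arguments.
Unset Strict Implicit.
Unset Printing Implicit Defensive.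
Import Order.TTheory GRing.Theory Num.Theory.
Local Open Scope ring_scope.

(* In the k-regular case |N_u \cup N_v| >= k, so d_uv <= |N_u \Delta N_v| / k,
   and for u, v in a common cluster of C the triangle inequality through that
   cluster bounds this by (y(u) + y(v)) / k.  Together with a count of the
   common neighbours of vertices in different clusters, the fractional cost F(u)
   of d at u is at most 3 y(u) plus twice the average of y over N_u.  Summing
   over u, or taking the maximum, gives 5 times the l_1, resp. l_oo, cost of C.
   Conversely the Jaccard distance d is a semi-metric, and KMZ rounding of a
   semi-metric with values in [0, 1] has at most 5 F(u) disagreements at u. *)

(** * Size of the symmetric difference of two finite sets *)

Definition hamming (T : finType) (A B : {set T}) : nat :=
  (\sum_(x : T) ((x \in A) != (x \in B)))%N.

Lemma card_indicator (T : finType) (A : {set T}) :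
  #|A| = (\sum_(x : T) (x \in A))%N.
Proof. by rewrite -sum1_card big_mkcond; apply: eq_bigr => x _; case: ifP. Qed.

Lemma hamming_sym (T : finType) (A B : {set T}) : hamming A B = hamming B A.
Proof. by apply: eq_bigr => x _; rewrite eq_sym. Qed.

Lemma hamming_triangle (T : finType) (A B C : {set T}) :
  (hamming A C <= hamming A B + hamming B C)%N.
Proof.
rewrite -big_split /=; apply: leq_sum => x _.
by case: (x \in A); case: (x \in B); case: (x \in C).
Qed.

Lemma cardsU_hamming (T : finType) (A B : {set T}) :
  #|A :|: B| = (hamming A B + #|A :&: B|)%N.
Proof.
rewrite !card_indicator -big_split /=; apply: eq_bigr => x _.
by rewrite !inE; case: (x \in A); case: (x \in B).
Qed.

(* Elements of [B] outside [A :|: C] are counted twice on the right. *)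
Lemma hamming_triangleU (T : finType) (A B C : {set T}) :
  (hamming A C + #|A :|: B :|: C| <= hamming A B + hamming B C + #|A :|: C|)%N.
Proof.
rewrite !card_indicator -!big_split /=; apply: leq_sum => x _.
by rewrite !inE; case: (x \in A); case: (x \in B); case: (x \in C).
Qed.

(** * The Jaccard distance is a semi-metric with values in [0, 1] *)

Section CorrelationMetric.
Variables (R : realType) (V : finType) (G : cc_instance V).
Local Notation N := (Npos G).
Local Notation d := (corr_metric R G).

Lemma NposU_gt0 (u v : V) : (0 < #|N u :|: N v|)%N.
Proof. by apply/card_gt0P; exists u; rewrite !inE pos_refl. Qed.

Lemma corr_metricE (u v : V) :
  d u v = (hamming (N u) (N v))%:R / #|N u :|: N v|%:R.
Proof.
have U0 : #|N u :|: N v|%:R != 0 :> R by rewrite pnatr_eq0 -lt0n NposU_gt0.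
apply: (mulIf U0); rewrite /corr_metric mulrBl mul1r !divfK //.
by rewrite cardsU_hamming natrD addrK.
Qed.

Lemma corr_metric_ge0 (u v : V) : 0 <= d u v.
Proof. by rewrite corr_metricE divr_ge0 ?ler0n. Qed.

Lemma corr_metric_le1 (u v : V) : d u v <= 1.
Proof. by rewrite /corr_metric gerBl divr_ge0 ?ler0n. Qed.

Lemma corr_metric_sym (u v : V) : d u v = d v u.
Proof. by rewrite /corr_metric setIC setUC. Qed.

(** Passing to the common denominator [#|S|] only shrinks the two fractions on the right. Write h
    and U for the Hamming distance and the size of the union of [N u] and [N w], and H for the sum
    of the other two Hamming distances. Then H >= h + |S| - U, and H U >= h |S| follows from (|S| -
    U)(U - h) >= 0. *)
Lemma corr_metric_triangle (u v w : V) : d u w <= d u v + d v w.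
Proof.
set S := (N u :|: N v :|: N w).
have S0 : 0 < #|S|%:R :> R.
  by rewrite ltr0n; apply/card_gt0P; exists u; rewrite !inE pos_refl.
have le_S a b : N a :|: N b \subset S ->
    (hamming (N a) (N b))%:R / #|S|%:R <= d a b.
  move=> /subset_leq_card le_abS; rewrite corr_metricE.
  by rewrite ler_wpM2l ?ler0n // lef_pV2 ?ler_nat // posrE ltr0n NposU_gt0.
have uvS : N u :|: N v \subset S by apply: subsetUl.
have vwS : N v :|: N w \subset S by rewrite setSU ?subsetUr.
apply: le_trans (lerD (le_S _ _ uvS) (le_S _ _ vwS)).
rewrite -mulrDl ler_pdivlMr // corr_metricE mulrAC ler_pdivrMr; last first.
  by rewrite ltr0n NposU_gt0.
rewrite -natrD -!natrM ler_nat.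
have := hamming_triangleU (N u) (N v) (N w); rewrite -/S.
have : (hamming (N u) (N w) <= #|N u :|: N w|)%N.
  by rewrite cardsU_hamming leq_addr.
have : (#|N u :|: N w| <= #|S|)%N.
  by apply: subset_leq_card; rewrite /S setUAC subsetUl.
nia.
Qed.

End CorrelationMetric.

(** * Fractional cost of the correlation metric at one vertex *)

Lemma disagreements_hamming (V : finType) (G : cc_instance V)
    (C : {set {set V}}) (u : V) :
  disagreements G C u = hamming (Npos G u) (pblock C u).
Proof.
rewrite /disagreements !card_indicator -big_split /=; apply: eq_bigr => x _.
by rewrite !inE; case: pos; case: (x \in pblock C u).
Qed.

Section FractionalCost.
Variables (R : realType) (V : finType) (G : cc_instance V).
Variables (k : nat) (C : {set {set V}}).
Hypothesis degG : forall u, #|Npos G u| = k.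
Hypothesis clC : is_clustering C.
Local Notation N := (Npos G).
Local Notation y := (disagreements G C).

Lemma mem_pblockT (u : V) : u \in pblock C u.
Proof. by rewrite mem_pblock (cover_partition clC) inE. Qed.

Lemma hamming_same_cluster (u v : V) :
  v \in pblock C u -> (hamming (N u) (N v) <= y u + y v)%N.
Proof.
move=> uv; have Kuv := same_pblock (partition_trivIset clC) uv.
rewrite !disagreements_hamming Kuv [X in (_ + X)%N]hamming_sym.
exact: hamming_triangle.
Qed.

(* A common neighbour [w] of [u] and [v] is cut off either from [u] or from
   [v]. *)
Lemma common_neighbours_across (u : V) :
  (\sum_(v | v \notin pblock C u) #|N u :&: N v|
     <= k * (\sum_(w in N u) (w \notin pblock C u)) + \sum_(w in N u) y w)%N.
Proof.
rewrite big_distrr /= -big_split /=.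
rewrite (eq_bigr (fun v => \sum_(w in N u) (v \in N w))%N); last first.
  move=> v _; rewrite card_indicator [RHS]big_mkcond; apply: eq_bigr => w _.
  by rewrite !inE [pos G w v]pos_sym; case: (pos G u w).
rewrite exchange_big; apply: leq_sum => w _.
(* If [w] is outside the cluster of [u], its [k] neighbours bound the count of [v]; otherwise each
   such [v] is a positive neighbour of [w] outside the cluster of [w], hence a disagreement at
   [w]. *)
case: (boolP (w \in pblock C u)) => wK; last first.
  rewrite muln1 -(degG w) card_indicator big_mkcond /=.
  apply: leq_trans (leq_addr _ _).
  by apply: leq_sum => v _; case: ifP.
rewrite disagreements_hamming (same_pblock (partition_trivIset clC) wK) muln0 add0n.
rewrite big_mkcond /=.
by apply: leq_sum => v _; case: (v \in N w); case: (v \in pblock C u).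
Qed.

Definition fractional_cost (z : V -> V -> R) (u : V) : R :=
  \sum_(v in N u) z u v + \sum_(v in Nneg G u) (1 - z u v).

Lemma fractional_cost_le (u : V) :
  k%:R * fractional_cost (corr_metric R G) u
    <= (3 * k * y u + 2 * \sum_(v in N u) y v)%:R.
Proof.
set K := pblock C u.
have k0 : 0 < k%:R :> R.
  by rewrite ltr0n -(degG u); apply/card_gt0P; exists u; rewrite inE pos_refl.
have kU v : k%:R <= #|N u :|: N v|%:R :> R.
  by rewrite ler_nat -(degG u) subset_leq_card ?subsetUl.
have kdiv v (a : nat) : k%:R * (a%:R / #|N u :|: N v|%:R) <= a%:R :> R.
  by rewrite mulrCA ler_piMr ?ler0n // ler_pdivrMr ?mul1r // (lt_le_trans k0).
(* For [v] outside [K] the trivial bound [d <= 1] suffices, since the positive edge is itself a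
   disagreement at [u]. *)
have posv v : k%:R * corr_metric R G u v
    <= (k * (v \notin K) + (y u + y v))%:R.
  have [vK|vK] := boolP (v \in K); last first.
    rewrite natrD muln1 (@le_trans _ _ k%:R) ?lerDl ?ler0n //.
    by rewrite ler_piMr ?ler0n ?corr_metric_le1.
  rewrite muln0 add0n corr_metricE (le_trans (kdiv _ _)) // ler_nat.
  exact: hamming_same_cluster.
(* For [v] in [K] the negative edge is a disagreement at [u]; otherwise the common neighbours are
   kept, to be counted globally by [across]. *)
have negv v : k%:R * (1 - corr_metric R G u v)
    <= (k * (v \in K) + (if v \notin K then #|N u :&: N v| else 0))%:R.
  rewrite /corr_metric subKr; case: (v \in K) => /=; last first.
    by rewrite muln0 add0n kdiv.
  rewrite addn0 muln1 ler_piMr ?ler0n // ler_pdivrMr ?ltr0n ?NposU_gt0 //.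
  by rewrite mul1r ler_nat subset_leq_card // subIset // subsetUl.
rewrite /fractional_cost mulrDr !mulr_sumr.
apply: le_trans (lerD (ler_sum _ (fun v _ => posv v))
  (ler_sum _ (fun v _ => negv v))) _.
rewrite -!natr_sum -natrD ler_nat.
have cutE : (\sum_(v in N u) (v \notin K) = #|[set w in N u | w \notin K]|)%N.
  rewrite card_indicator big_mkcond; apply: eq_bigr => v _.
  by rewrite !inE; case: pos.
have joinE : (\sum_(v in Nneg G u) (v \in K) = #|[set w in Nneg G u | w \in K]|)%N.
  rewrite card_indicator big_mkcond; apply: eq_bigr => v _.
  by rewrite !inE; case: pos.
have acrossE : (\sum_(v in Nneg G u) (if v \notin K then #|N u :&: N v| else 0)
    <= \sum_(v | v \notin K) #|N u :&: N v|)%N.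
  rewrite big_mkcond [X in (_ <= X)%N]big_mkcond.
  by apply: leq_sum => v _; do 2!case: ifP => //.
have across := common_neighbours_across u; rewrite -/K in across.
have yuE : y u = (#|[set w in N u | w \notin K]| + #|[set w in Nneg G u | w \in K]|)%N.
  by [].
move: (disagreements G C) yuE across => Y.
(* The coefficient 3 of [k * y u]: one from the disagreements of both signs in [posv] and [negv],
   one from the term [y u] summed over [k] neighbours, one from the cut edges in [across]. The sums
   of [y] in [posv] and [across] give the 2. *)
rewrite !big_split /= -!big_distrr /= sum_nat_const degG cutE joinE; move: acrossE.
move: (\sum_(v | _) _)%N (\sum_(v in Nneg G u) _)%N (\sum_(v in N u) _)%N.
move: #|_| #|_| (Y u); nia.
Qed.

End FractionalCost.

(** * KMZ rounding of a semi-metric, vertex by vertex *)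

Section KMZ.
Variables (R : realType) (V : finType) (z : V -> V -> R).
Hypothesis z_refl : forall u, z u u = 0.

Lemma kmz_run_partition (W : {set V}) (s : seq {set V}) :
  kmz_run z W s -> partition [set:: s] W.
Proof.
elim=> {W s} [|W u s uW _ _ IH]; first by rewrite set_nil partition_set0.
set K := kmz_cluster z W u.
have KW : K \subset W by apply: subsetIr.
have -> : W = K :|: (W :\: K).
  by rewrite -[LHS](setID W K) (setIidPr KW).
rewrite set_cons; apply: partitionU1 => //.
  apply/set0Pn; exists u; rewrite !inE uW andbT z_refl.
  by rewrite mulr_ge0 ?divr_ge0 ?ler0n.
by rewrite -setI_eq0 setIDA setDIl setDv set0I.
Qed.

Hypothesis z_ge0 : forall u v, 0 <= z u v.
Hypothesis z_le1 : forall u v, z u v <= 1.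
Hypothesis z_sym : forall u v, z u v = z v u.
Hypothesis z_triangle : forall u v w, z u w <= z u v + z v w.
Variable p : rel V.
Local Notation r := (kmz_radius R).

(** Stated on the list of clusters rather than with [pblock], so that it unfolds along the induction
    on a run. *)
Definition same_cluster (s : seq {set V}) (u v : V) : bool :=
  has (fun K : {set V} => (u \in K) && (v \in K)) s.

(** The fractional charge of a pair minus [r] if the pair disagrees: nonnegative total profit at [u]
    bounds its disagreements by [1 / r = 5] times its fractional cost. *)
Definition profit (u v : V) (same : bool) : R :=
  (if p u v then z u v else 1 - z u v) - r * (p u v != same)%:R.

Definition gain (u v : V) : R := if z u v <= r then r - z u v else 0.

Lemma gain_ge0 (u v : V) : 0 <= gain u v.
Proof. by rewrite /gain; case: ifP => // zr; rewrite subr_ge0. Qed.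

Lemma kmz_weightE (W : {set V}) (u : V) :
  kmz_weight z W u = \sum_(v in W) gain u v.
Proof.
rewrite /kmz_weight big_mkcond [RHS]big_mkcond; apply: eq_bigr => v _.
by rewrite !inE /gain; case: (v \in W); rewrite ?andbT ?andbF.
Qed.

(** Amortisation: [X] contains the whole [r]-ball of [w] in [W], so the gains of [w] over [X] add up
    to its full weight, while those of [u] add up to at most the weight of [u]. *)
Lemma profit_step (W : {set V}) (w u : V) (X : {set V}) (same : V -> bool) :
  X \subset W -> {in W, forall v, z w v <= r -> v \in X} ->
  kmz_weight z W u <= kmz_weight z W w ->
  {in X, forall v, gain w v - gain u v <= profit u v (same v)} ->
  0 <= \sum_(v in X) profit u v (same v).
Proof.
move=> XW wX wmax gX.
apply: le_trans (ler_sum _ gX); rewrite sumrB subr_ge0.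
move: wmax; rewrite !kmz_weightE (big_setID X) /= (setIidPr XW).
rewrite [X in _ <= X -> _](big_setID X) /= (setIidPr XW).
rewrite [X in _ <= _ + X -> _]big1 ?addr0; last first.
  move=> v /setDP[vW vX]; rewrite /gain; case: ifP => // /(wX v vW).
  by rewrite (negbTE vX).
by apply: le_trans; rewrite lerDl sumr_ge0 // => v _; apply: gain_ge0.
Qed.

(* The total profit of the pairs settled when the cluster around [w] is removed
   is nonnegative: either every pair has nonnegative profit, or the losses of
   [u] are at most its weight, hence at most the weight of the chosen center
   [w], which is gained on the ball around [w]. *)
Lemma kmz_step_profit (W : {set V}) (w u : V) :
  u \in W -> kmz_weight z W u <= kmz_weight z W w ->
  0 <= \sum_(v in if u \in kmz_cluster z W w then W else kmz_cluster z W w)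
         profit u v ((u \in kmz_cluster z W w) && (v \in kmz_cluster z W w)).
Proof.
move=> uW wmax; set K := kmz_cluster z W w.
have r5 : 5%:R * r = 1 by rewrite /kmz_radius; field.
have memK v : v \in W -> (v \in K) = (z w v <= 2%:R * r).
  by move=> vW; rewrite !inE vW andbT.
have KW : K \subset W by apply: subsetIr.
have wK : {in W, forall v, z w v <= r -> v \in K}.
  by move=> v vW zr; rewrite memK //; lra.
have t1 v := z_triangle u w v; have t2 v := z_triangle w v u.
have t3 v := z_triangle w u v.
rewrite (memK u uW) (z_sym w u); case: ifPn => [zu|]; last rewrite -ltNge => zu.
  (* Within [r] of the center every pair has nonnegative profit: a negative pair inside has length
     at most [3 r], a cut positive pair at least [r]. Between [r] and [2 r], a negative pair inside
     can reach [4 r], still nonnegative as [5 r = 1], and short cut positive pairs are paid by the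
     weights. *)
  have [zur|zur] := leP (z u w) r.
    apply: sumr_ge0 => v vW; rewrite /profit (memK v vW) /=.
    have {t1 t2 t3} [h1 h2 h3] := And3 (t1 v) (t2 v) (t3 v).
    have [h4 h5] := (z_ge0 u v, z_le1 u v); rewrite (z_sym v u) (z_sym w u) in h1 h2 h3.
    by case: (leP (z w v)) => zwv; case: (p u v) => /=; lra.
  apply: (@profit_step W w u W (fun v => v \in K) _ _ wmax) => // v vW.
  rewrite /profit /gain (memK v vW) /=.
  have {t1 t2 t3} [h1 h2 h3] := And3 (t1 v) (t2 v) (t3 v).
  have [h4 h5] := (z_ge0 u v, z_le1 u v); rewrite (z_sym v u) (z_sym w u) in h1 h2 h3.
  by case: (leP (z w v) (2%:R * r)) => zwv2; case: (leP (z w v) r) => zwv1;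
    case: (leP (z u v)) => zuv; case: (p u v) => /=; lra.
(* Beyond [3 r], every cut positive pair has length at least [r] and pays for itself. Between [2 r]
   and [3 r], shorter ones may occur and the weights are compared on [K]. *)
have [zur|zur] := leP (3%:R * r) (z u w).
  apply: sumr_ge0 => v vK; rewrite /profit.
  have zwv2 := vK; rewrite (memK v (subsetP KW v vK)) in zwv2.
  have {t1 t2 t3} [h1 h2 h3] := And3 (t1 v) (t2 v) (t3 v).
  have [h4 h5] := (z_ge0 u v, z_le1 u v); rewrite (z_sym v u) (z_sym w u) in h1 h2 h3.
  by case: (p u v) => /=; lra.
apply: (@profit_step W w u K xpred0 _ _ wmax) => // v vK.
rewrite /profit /gain.
have zwv2 := vK; rewrite (memK v (subsetP KW v vK)) in zwv2.
have {t1 t2 t3} [h1 h2 h3] := And3 (t1 v) (t2 v) (t3 v).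
have [h4 h5] := (z_ge0 u v, z_le1 u v); rewrite (z_sym v u) (z_sym w u) in h1 h2 h3.
by case: (leP (z w v)) => zwv; case: (leP (z u v)) => zuv; case: (p u v) => /=; lra.
Qed.

(** A pair is settled by the first cluster that removes one of its ends, as later clusters lie in
    the remaining set. If [u] is removed, all its pairs in [W] are settled; otherwise those in [K]
    are, and induction handles the rest. *)
Lemma kmz_run_profit (W : {set V}) (s : seq {set V}) :
  kmz_run z W s ->
  forall u, u \in W -> 0 <= \sum_(v in W) profit u v (same_cluster s u v).
Proof.
elim=> {W s} [u|W w s wW wmax run IH u uW]; first by rewrite inE.
set K := kmz_cluster z W w.
have sW A v : A \in s -> v \in A -> v \in W :\: K.
  move=> As; apply/subsetP/(partitionS (kmz_run_partition run)).
  by rewrite inE.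
have notin_s v u' : (v \in K) || (u' \in K) -> same_cluster s v u' = false.
  move=> vuK; apply/hasPn => A As; apply: contraL vuK => /andP[vA uA].
  have := sW A v As vA; have := sW A u' As uA.
  by rewrite !in_setD => /andP[/negbTE-> _] /andP[/negbTE-> _].
have KW : K \subset W by apply: subsetIr.
have := kmz_step_profit uW (wmax u uW); rewrite -/K /=.
have [uK|uK] := boolP (u \in K) => step.
  congr (0 <= _): step; apply: eq_bigr => v _.
  by rewrite /= notin_s ?uK ?orbF.
rewrite (big_setID K) /= (setIidPr KW) addr_ge0 //.
  congr (0 <= _): step; apply: eq_bigr => v vK.
  by rewrite /= notin_s ?vK ?orbT.
by rewrite IH // in_setD uK.
Qed.

End KMZ.

Lemma kmz_disagreements_le (R : realType) (V : finType) (G : cc_instance V)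
    (z : V -> V -> R) (C : {set {set V}}) (u : V) :
  (forall u, z u u = 0) -> (forall u v, 0 <= z u v) ->
  (forall u v, z u v <= 1) -> (forall u v, z u v = z v u) ->
  (forall u v w, z u w <= z u v + z v w) ->
  kmz_output z C ->
  (disagreements G C u)%:R <= 5%:R * fractional_cost G z u.
Proof.
move=> z_refl z_ge0 z_le1 z_sym z_triangle [s run ->{C}].
have part := kmz_run_partition z_refl run.
have same v : same_cluster s u v = (v \in pblock [set:: s] u).
  have ucov : u \in cover [set:: s] by rewrite (cover_partition part) inE.
  apply/hasP/idP => [[A As /andP[uA vA]]|vP].
    by rewrite (def_pblock (partition_trivIset part) _ uA) // inE.
  exists (pblock [set:: s] u); last by rewrite mem_pblock ucov.
  by have := pblock_mem ucov; rewrite inE.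
have := kmz_run_profit z_refl z_ge0 z_le1 z_sym z_triangle (pos G) run (in_setT u).
rewrite sumrB -mulr_sumr subr_ge0 disagreements_hamming /hamming natr_sum.
have -> : \sum_(v in [set: V]) (if pos G u v then z u v else 1 - z u v)
    = fractional_cost G z u.
  rewrite /fractional_cost (big_setID (Npos G u)) /= setTI.
  congr (_ + _); last first.
    apply: eq_big => v; rewrite !inE ?andbT // => /negbTE puv.
    by rewrite puv.
  by apply: eq_bigr => v; rewrite inE => ->.
have -> : \sum_(v in [set: V]) (pos G u v != same_cluster s u v)%:R
    = \sum_v ((v \in Npos G u) != (v \in pblock [set:: s] u))%:R :> R.
  by apply: eq_big => v; rewrite ?inE // => _; rewrite same.
by rewrite /kmz_radius; lra.
Qed.

(** * The two norms of the disagreement vector *)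

Section LpNorm.
Variables (R : realType) (V : finType) (G : cc_instance V).

Lemma clustering_cost1 (C : {set {set V}}) :
  clustering_cost G 1%:E C = \sum_u (disagreements G C u)%:R :> R.
Proof.
rewrite /clustering_cost /lp_norm invr1 powRr1; last first.
  by apply: sumr_ge0 => u _; apply: powR_ge0.
by apply: eq_bigr => u _; rewrite powRr1 // normr_nat.
Qed.

Lemma clustering_cost_oo_le (C : {set {set V}}) (M : R) :
  0 <= M -> (forall u, (disagreements G C u)%:R <= M) ->
  clustering_cost G +oo%E C <= M.
Proof.
move=> M0 leM; rewrite /clustering_cost /lp_norm.
by apply: (big_ind (fun x => x <= M)) => // [a b|u _]; [rewrite ge_max => -> ->|rewrite normr_nat].
Qed.

Lemma disagreements_le_cost_oo (C : {set {set V}}) (u : V) :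
  (disagreements G C u)%:R <= clustering_cost G +oo%E C :> R.
Proof.
rewrite /clustering_cost /lp_norm -{1}(normr_nat R (disagreements G C u)).
exact: (le_bigmax _ (fun v => `|(disagreements G C v)%:R|)).
Qed.

End LpNorm.

(** * Fractional cost against an arbitrary clustering, in both norms *)

Lemma sum_fractional_cost_le (R : realType) (V : finType) (G : cc_instance V)
    (C : {set {set V}}) :
  pos_regular G -> is_clustering C ->
  \sum_u fractional_cost G (corr_metric R G) u
    <= 5%:R * \sum_u (disagreements G C u)%:R.
Proof.
case=> k degG clC.
(* By symmetry and regularity each [v] is counted once from each of its [k] neighbours, so the
   neighbourhood averages sum to the total of [y]. *)
have sumN : (\sum_u \sum_(v in Npos G u) disagreements G C v
    = k * \sum_u disagreements G C u)%N.
  rewrite big_distrr /= (exchange_big_dep predT) //=; apply: eq_bigr => v _.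
  rewrite sum_nat_const -(degG v); congr (_ * _)%N; apply: eq_card => u.
  by rewrite -[LHS]/(v \in Npos G u) !inE pos_sym.
(* A vertex is needed for [k > 0]; on empty [V] both sides are 0. *)
have [u _|noV] := pickP (mem V); last by rewrite !big1 ?mulr0 // => u; have := noV u.
have k0 : 0 < k%:R :> R.
  by rewrite ltr0n -(degG u); apply/card_gt0P; exists u; rewrite inE pos_refl.
rewrite -(ler_pM2l k0) mulr_sumr.
apply: le_trans (ler_sum _ (fun v _ => fractional_cost_le R degG clC v)) _.
rewrite -!natr_sum -!natrM ler_nat big_split /= -!big_distrr /= sumN.
by move: (\sum_u _)%N; nia.
Qed.

Lemma fractional_cost_le_cost_oo (R : realType) (V : finType)
    (G : cc_instance V) (C : {set {set V}}) (u : V) :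
  pos_regular G -> is_clustering C ->
  fractional_cost G (corr_metric R G) u <= 5%:R * clustering_cost G +oo%E C.
Proof.
case=> k degG clC; set M := clustering_cost G +oo%E C.
have k0 : 0 < k%:R :> R.
  by rewrite ltr0n -(degG u); apply/card_gt0P; exists u; rewrite inE pos_refl.
rewrite -(ler_pM2l k0); apply: le_trans (fractional_cost_le R degG clC u) _.
have yM v : (disagreements G C v)%:R <= M by apply: disagreements_le_cost_oo.
have sumM : \sum_(v in Npos G u) (disagreements G C v)%:R <= k%:R * M.
  apply: le_trans (ler_sum _ (fun v _ => yM v)) _.
  by rewrite sumr_const degG mulr_natl.
have yuM : k%:R * (disagreements G C u)%:R <= k%:R * M by rewrite ler_pM2l.
by rewrite natrD !natrM natr_sum; lra.
Qed.

Theorem theorem2 (R : realType) :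
  (exists c : R, 0 < c /\
     forall (V : finType) (G : cc_instance V), pos_regular G ->
       \sum_(u : V) \sum_(v in Npos G u) corr_metric R G u v
       + \sum_(u : V) \sum_(v in Nneg G u) (1 - corr_metric R G u v)
       <= c * OPT G 1%:E)
  /\
  (exists c : R, 0 < c /\
     forall (V : finType) (G : cc_instance V), pos_regular G ->
       forall C : {set {set V}}, kmz_output (corr_metric R G) C ->
         approximates G c 1%:E C /\ approximates G c +oo%E C).
Proof.
split.
  exists 5%:R; split=> // V G regG.
  have [C clC <-] := OPT_attained G (1%:E : \bar R).
  by rewrite clustering_cost1 -big_split; apply: sum_fractional_cost_le.
(* A factor 5 from the rounding times a factor 5 from the fractional cost. *)
exists 25%:R; split=> // V G regG C outC.
have clC : is_clustering C.
  by case: outC => s run ->; apply: (kmz_run_partition (corr_metric_diag R G) run).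
have yC u : (disagreements G C u)%:R
    <= 5%:R * fractional_cost G (corr_metric R G) u.
  apply: kmz_disagreements_le outC.
  - exact: corr_metric_diag.
  - exact: corr_metric_ge0.
  - exact: corr_metric_le1.
  - exact: corr_metric_sym.
  - exact: corr_metric_triangle.
split; split=> //.
  have [D clD <-] := OPT_attained G (1%:E : \bar R).
  rewrite !clustering_cost1; apply: le_trans (ler_sum _ (fun u _ => yC u)) _.
  by rewrite -mulr_sumr; have := sum_fractional_cost_le R regG clD; lra.
have [D clD <-] := OPT_attained G (+oo%E : \bar R).
have D0 : 0 <= clustering_cost G +oo%E D :> R.
  by apply: (big_ind (fun x => 0 <= x)) => // a b a0 b0; rewrite le_max a0.
apply: clustering_cost_oo_le => [|u]; first by rewrite mulr_ge0.
by have := yC u; have := fractional_cost_le_cost_oo R u regG clD; lra.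
Qed.
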